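(* Let $a\in(0,1)$, $\rho>0$ and $\lambda_i>0$. For each positive integer $g$, let $\lambda_{i,g}^{(\underline{\infty})}$ and $\lambda_{i,g}^{(\overline{\infty})}$ denote the minimum and maximum steady-state channel MSE for the block time-wise interval $g$, i.e. $$\lambda_{i,g}^{(\underline{\infty})}=\frac{\lambda_i}{\frac{1}{2}(1+\lambda_i\rho)+\sqrt{\left(\frac{1}{2}(1+\lambda_i\rho)\right)^2+\frac{a^{2g}}{1-a^{2g}}\lambda_i\rho}},\qquad \lambda_{i,g}^{(\overline{\infty})}=a^{2(g-1)}\lambda_{i,g}^{(\underline{\infty})}+\left(1-a^{2(g-1)}\right)\lambda_i .$$ Then $\lambda_{i,g}^{(\overline{\infty})}$ is a monotonically increasing function of $g$; that is, $\lambda_{i,g'}^{(\overline{\infty})}\le\lambda_{i,g}^{(\overline{\infty})}$ for all positive integers $g',g$ with $1\le g'\le g$.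
   Context: Here $a$ is the temporal fading correlation coefficient of a first-order Gauss-Markov channel, $\rho$ is the training power, and $\lambda_i$ is a (non-zero) eigenvalue of the channel covariance matrix. The interval $g$ is the number of blocks between consecutive transmissions of the training signal along the $i$-th eigenvector. The quantity $\lambda_{i,g}^{(\underline{\infty})}$ is the steady-state Kalman estimation error variance along the $i$-th eigenvector right after a training transmission, and $\lambda_{i,g}^{(\overline{\infty})}$ is the steady-state error variance after $g-1$ further blocks without training in that direction. Only the two displayed formulas are needed for the claim. *)

(* Defs.v *)
From Stdlib Require Export Reals.
Open Scope R_scope.

(* Here a is the temporal fading correlation coefficient, rho the training
   power, lam a channel covariance eigenvalue and g the interval, in blocks,
   between consecutive training transmissions.  The formulas are meant for
   (1 <= g)%nat, so that the truncated subtraction g - 1 is the usual one;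
   at g = 0 they carry no meaning. *)

Definition mse_min (a rho lam : R) (g : nat) : R :=
  lam /
  (1 / 2 * (1 + lam * rho) +
   sqrt ((1 / 2 * (1 + lam * rho)) ^ 2 +
         a ^ (2 * g) / (1 - a ^ (2 * g)) * (lam * rho))).

Definition mse_max (a rho lam : R) (g : nat) : R :=
  a ^ (2 * (g - 1)) * mse_min a rho lam g +
  (1 - a ^ (2 * (g - 1))) * lam.

(* Main.v *)
Require Import Defs.
From Stdlib Require Import Reals.
From Stdlib Require Import Lra Lia.
Open Scope R_scope.

(** The gap [lam - mse_max] equals [a ^ (2 * (g - 1)) * (lam - mse_min)], so it suffices that both
    factors are nonnegative and nonincreasing in [g]. The power is, since [0 < a < 1]; for the other
    factor, [mse_min_monotone] gives the decrease and [mse_min_le] the sign. *)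

Lemma pow_antitone (a : R) (m n : nat) :
  0 < a < 1 -> (m <= n)%nat -> a ^ n <= a ^ m.
Proof.
  intros ha hmn.
  replace n with (m + (n - m))%nat by lia.
  rewrite pow_add.
  assert (h1 : a ^ (n - m) <= 1).
  { rewrite <- (pow1 (n - m)). apply pow_incr; lra. }
  assert (h2 : 0 < a ^ m) by (apply pow_lt; lra).
  nra.
Qed.

Lemma odds_le (x y : R) : x <= y -> y < 1 -> x / (1 - x) <= y / (1 - y).
Proof.
  intros hxy hy.
  apply (Rmult_le_reg_r ((1 - x) * (1 - y))); [nra|].
  replace (x / (1 - x) * ((1 - x) * (1 - y))) with (x * (1 - y)) by (field; lra).
  replace (y / (1 - y) * ((1 - x) * (1 - y))) with (y * (1 - x)) by (field; lra).
  nra.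
Qed.

Lemma even_pow_bounds (a : R) (g : nat) :
  0 < a < 1 -> (1 <= g)%nat -> 0 < a ^ (2 * g) < 1.
Proof.
  intros ha hg; split; [apply pow_lt; lra|].
  apply pow_lt_1_compat; [lra|lia].
Qed.

(** The fading term under the root is nonnegative, so the denominator is at least twice
    [1 / 2 * (1 + lam * rho)], which exceeds 1. *)
Lemma mse_min_le (a rho lam : R) (g : nat) :
  0 < a < 1 -> 0 < rho -> 0 < lam -> (1 <= g)%nat ->
  mse_min a rho lam g <= lam.
Proof.
  intros ha hrho hlam hg; unfold mse_min.
  pose proof (even_pow_bounds a g ha hg) as hx.
  assert (hs : 0 < lam * rho) by nra.
  assert (hodds : 0 <= a ^ (2 * g) / (1 - a ^ (2 * g))).
  { apply Rlt_le, Rdiv_lt_0_compat; lra. }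
  set (c := 1 / 2 * (1 + lam * rho)).
  assert (hc : 1 / 2 < c) by (unfold c; lra).
  assert (hsqrt : c <= sqrt (c ^ 2 + a ^ (2 * g) / (1 - a ^ (2 * g)) * (lam * rho))).
  (* Writing the left-hand [c] as the root of [c ^ 2] reduces the claim to comparing radicands. *)
  { rewrite <- (sqrt_pow2 c) at 1 by lra. apply sqrt_le_1_alt. nra. }
  set (r := sqrt _) in *.
  apply (Rmult_le_reg_r (c + r)); [lra|].
  replace (lam / (c + r) * (c + r)) with lam by (field; lra).
  nra.
Qed.

(** The interval enters only through [x / (1 - x)] at [x = a ^ (2 * g)]. This ratio increases with
    [x], and [x] shrinks as [g] grows, so the denominator of [mse_min] shrinks too. *)
Lemma mse_min_monotone (a rho lam : R) (g' g : nat) :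
  0 < a < 1 -> 0 < rho -> 0 < lam -> (1 <= g')%nat -> (g' <= g)%nat ->
  mse_min a rho lam g' <= mse_min a rho lam g.
Proof.
  intros ha hrho hlam hg' hg; unfold mse_min.
  pose proof (even_pow_bounds a g' ha hg') as hx.
  assert (hs : 0 < lam * rho) by nra.
  assert (hodds : a ^ (2 * g) / (1 - a ^ (2 * g)) <= a ^ (2 * g') / (1 - a ^ (2 * g'))).
  { apply odds_le; [apply pow_antitone; [assumption|lia]|lra]. }
  apply Rmult_le_compat_l; [lra|].
  apply Rinv_le_contravar.
  - apply Rplus_lt_le_0_compat; [lra|apply sqrt_pos].
  - apply Rplus_le_compat_l, sqrt_le_1_alt, Rplus_le_compat_l.
    apply Rmult_le_compat_r; lra.
Qed.

Theorem proposition2 (a rho lam : R)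
    (ha : 0 < a < 1) (hrho : 0 < rho) (hlam : 0 < lam) :
  forall g' g : nat, (1 <= g')%nat -> (g' <= g)%nat ->
    mse_max a rho lam g' <= mse_max a rho lam g.
Proof.
  intros g' g hg' hg.
  pose proof (mse_min_monotone a rho lam g' g ha hrho hlam hg' hg) as hmin.
  (* The bound at the larger index suffices: multiplying the two inequalities needs only the smaller
     factors to be nonnegative. *)
  assert (hlam_g : mse_min a rho lam g <= lam) by (apply mse_min_le; auto; lia).
  assert (hpow : a ^ (2 * (g - 1)) <= a ^ (2 * (g' - 1))).
  { apply pow_antitone; [assumption|lia]. }
  assert (hpos : 0 < a ^ (2 * (g - 1))) by (apply pow_lt; lra).
  (* [mse_max = lam - a ^ (2 * (g - 1)) * (lam - mse_min)], where both factors
     are nonnegative and nonincreasing in [g]. *)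
  assert (hprod : a ^ (2 * (g - 1)) * (lam - mse_min a rho lam g)
                  <= a ^ (2 * (g' - 1)) * (lam - mse_min a rho lam g')).
  { apply Rmult_le_compat; lra. }
  unfold mse_max; lra.
Qed.
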